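(* Let $q$ be a power of a prime number. The derangement graph $\Gamma_{\operatorname{PGL}_2(q)}$ of $\operatorname{PGL}_2(q)$ acting on the projective line $\operatorname{PG}_1(q)$ is not a normal Cayley graph on $\operatorname{PGL}_2(q)$; that is, the left-regular representation $L_{\operatorname{PGL}_2(q)}$ is not a normal subgroup of $\operatorname{Aut}(\Gamma_{\operatorname{PGL}_2(q)})$.
   Context: $\operatorname{PG}_1(q)=\mathbb{F}_q\cup\{\infty\}$ is the set of $1$-dimensional subspaces of $\mathbb{F}_q^2$, and $\operatorname{PGL}_2(q)$ (i.e. $\operatorname{GL}_2(\mathbb{F}_q)$ modulo scalar matrices) acts faithfully on it in the natural way, by Möbius transformations. For a finite transitive permutation group $G\leqslant\operatorname{Sym}(\Omega)$, a derangement is an element of $G$ fixing no point of $\Omega$. The derangement graph $\Gamma_G$ is the simple undirected graph with vertex set $G$ in which $g,h\in G$ are adjacent if and only if $h^{-1}g$ is a derangement; it is the Cayley graph $\operatorname{Cay}(G,D_G)$, where $D_G$ is the set of derangements of $G$. $\operatorname{Aut}(\Gamma_G)\leqslant\operatorname{Sym}(G)$ is its full automorphism group. For $g\in G$ let $\lambda_g:G\to G$, $\lambda_g(x)=gx$, and $L_G=\{\lambda_g:g\in G\}\leqslant\operatorname{Sym}(G)$ (the left-regular representation). A Cayley graph $X$ on a group $G$ is called a normal Cayley graph if $L_G$ is a normal subgroup of $\operatorname{Aut}(X)$. *)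

(* Defs.v *)
From HB Require Import structures.
From mathcomp Require Import all_boot all_order all_algebra all_fingroup.

Set Implicit Arguments.
Unset Strict Implicit.
Unset Printing Implicit Defensive.

Import GroupScope GRing.Theory.

Section CayleyGraphs.

Variable gT : finGroupType.

(* A simple graph on the vertex set gT is given by its adjacency relation. *)
Definition cayley_graph (D : {set gT}) : rel gT := [rel g h | h^-1 * g \in D].

Definition graph_aut (e : rel gT) : {set {perm gT}} :=
  [set s : {perm gT} | [forall x, forall y, e (s x) (s y) == e x y]].

Lemma graph_autP (e : rel gT) (s : {perm gT}) :
  reflect (forall x y, e (s x) (s y) = e x y) (s \in graph_aut e).
Proof.
rewrite inE; apply: (iffP forallP) => [es x y | es x].
  by move/forallP: (es x) => /(_ y) /eqP.
by apply/forallP=> y; rewrite es.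
Qed.

Lemma graph_aut_group_set e : group_set (graph_aut e).
Proof.
apply/group_setP; split=> [|s t /graph_autP es /graph_autP et].
  by apply/graph_autP=> x y; rewrite !perm1.
by apply/graph_autP=> x y; rewrite !permM et es.
Qed.
Canonical graph_aut_group e := Group (graph_aut_group_set e).

Definition left_translation (g : gT) : {perm gT} := perm (@mulgI gT g).

Lemma left_translationE g x : left_translation g x = g * x.
Proof. by rewrite permE. Qed.

Definition left_regular : {set {perm gT}} := [set left_translation g | g : gT].

Lemma left_regular_group_set : group_set left_regular.
Proof.
apply/group_setP; split=> [|_ _ /imsetP[g _ ->] /imsetP[h _ ->]].
  apply/imsetP; exists 1; rewrite ?inE //.
  by apply/permP=> x; rewrite left_translationE perm1 mul1g.
apply/imsetP; exists (h * g); rewrite ?inE //.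
by apply/permP=> x; rewrite permM !left_translationE mulgA.
Qed.
Canonical left_regular_group := Group left_regular_group_set.

Definition normal_cayley (e : rel gT) : bool := left_regular <| graph_aut e.

Variables (Omega : finType) (to : {action gT &-> Omega}).

Definition derangements : {set gT} :=
  [set g | [forall w : Omega, to w g != w]].

Definition derangement_graph : rel gT := cayley_graph derangements.

End CayleyGraphs.

Section ProjectiveLine.

Variable F : finFieldType.

Lemma vspace_setK : cancel (fun U : {vspace 'rV[F]_2} => [set v | v \in U])
  (fun A : {set 'rV[F]_2} => <<enum A>>%VS).
Proof.
move=> U; apply/eqP; rewrite eqEsubv; apply/andP; split.
  by apply/span_subvP=> v; rewrite mem_enum inE.
by apply/subvP=> v vU; apply: memv_span; rewrite mem_enum inE.
Qed.

HB.instance Definition _ : isCountable {vspace 'rV[F]_2} :=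
  CanIsCountable vspace_setK.
HB.instance Definition _ : isFinite {vspace 'rV[F]_2} :=
  CanIsFinite vspace_setK.

Definition PG1 := {U : {vspace 'rV[F]_2} | \dim U == 1%N}.
HB.instance Definition _ := Finite.on PG1.

Definition scalar_GL : {set {'GL_2[F]}} := [set u | is_scalar_mx (GLval u)].

Lemma scalar_GL_group_set : group_set scalar_GL.
Proof.
apply/group_setP; split=> [|u v].
  by rewrite inE GL_1E scalar_mx_is_scalar.
rewrite !inE GL_ME => /is_scalar_mxP[a ->] /is_scalar_mxP[b ->].
by apply/is_scalar_mxP; exists (a * b)%R; rewrite scalar_mxM.
Qed.
Canonical scalar_GL_group := Group scalar_GL_group_set.

Lemma scalar_GL_normal : scalar_GL <| 'GL_2[F].
Proof.
apply/andP; split; first exact: subsetT.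
apply/subsetP=> u _; rewrite inE; apply/subsetP=> _ /imsetP[v + ->].
rewrite inE => /is_scalar_mxP[a va]; suff -> : v ^ u = v.
  by rewrite inE va scalar_mx_is_scalar.
apply/conjg_fixP/commgP; apply: val_inj.
by rewrite /= -[val v]/(GLval v) va; apply/esym; apply: scalar_mxC.
Qed.

(* coset_of Z consists of the cosets of Z in 'N(Z); as Z is normal in GL_2,
   it is the carrier of GL_2 / Z, cf. PGL2_quotient. *)
Definition PGL2 := coset_of scalar_GL.
HB.instance Definition _ := FinGroup.on PGL2.

Lemma PGL2_quotient : 'GL_2[F] / scalar_GL = [set: PGL2].
Proof.
apply/setP=> x; rewrite !inE; have [u Nu ->] := cosetP x.
by rewrite mem_quotient ?inE.
Qed.

(* Actions are on the right, so GL_2 acts on row vectors by v |-> v *m u. *)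
Definition GL_image (U : {vspace 'rV[F]_2}) (u : {'GL_2[F]}) :
  {vspace 'rV[F]_2} := (linfun (mulmxr (GLval u)) @: U)%VS.

Lemma GL_image1 U : GL_image U 1 = U.
Proof.
rewrite /GL_image -[RHS]lim1g; congr (_ @: _)%VS.
by apply/lfunP=> v; rewrite lfunE /= id_lfunE mulmx1.
Qed.

Lemma GL_imageM U u v : GL_image U (u * v) = GL_image (GL_image U u) v.
Proof.
rewrite /GL_image -limg_comp; congr (_ @: _)%VS.
by apply/lfunP=> w; rewrite comp_lfunE !lfunE /= mulmxA.
Qed.

Lemma dim_GL_image U u : \dim (GL_image U u) = \dim U.
Proof.
apply/limg_dim_eq/eqP; rewrite -subv0; apply/subvP=> v /memv_capP[_].
rewrite memv_ker lfunE /= => /eqP vu0; rewrite memv0.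
by rewrite -[v](mulmxK (GL_unit u)) vu0 mul0mx.
Qed.

Lemma GL_image_scalar U u : u \in scalar_GL -> GL_image U u = U.
Proof.
rewrite inE => /is_scalar_mxP[a ua]; have a0 : a != 0%R.
  by apply: contraTneq (GL_unit u) => a0; rewrite ua a0 raddf0 unitr0.
apply/eqP; rewrite eqEdim dim_GL_image leqnn andbT.
apply/subvP=> _ /memv_imgP[v vU ->]; rewrite lfunE /= ua mul_mx_scalar.
exact: memvZ.
Qed.

Lemma GL_image_coset U (u : {'GL_2[F]}) :
  GL_image U (repr (coset scalar_GL u)) = GL_image U u.
Proof.
rewrite val_coset ?(subsetP (normal_norm scalar_GL_normal)) ?inE //.
have [z Zz] := repr_rcosetP scalar_GL_group u.
by rewrite GL_imageM (GL_image_scalar _ Zz).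
Qed.

Lemma PG1_act_subproof (L : PG1) (x : PGL2) :
  \dim (GL_image (val L) (repr x)) == 1%N.
Proof. by rewrite dim_GL_image (valP L). Qed.

(* By GL_image_coset, the choice of the representative of x is irrelevant. *)
Definition PG1_act (L : PG1) (x : PGL2) : PG1 :=
  exist _ (GL_image (val L) (repr x)) (PG1_act_subproof L x).

Lemma PG1_act_coset (L : PG1) (u : {'GL_2[F]}) :
  val (PG1_act L (coset scalar_GL u)) = GL_image (val L) u.
Proof. exact: GL_image_coset. Qed.

Lemma PG1_act1 : PG1_act^~ 1 =1 id.
Proof.
move=> L; apply: val_inj; rewrite -(coset_id (group1 scalar_GL_group)).
by rewrite PG1_act_coset GL_image1.
Qed.

Lemma PG1_actM L : act_morph PG1_act L.
Proof.
move=> x y; have [u Nu ->] := cosetP x; have [v Nv ->] := cosetP y.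
apply: val_inj; rewrite PG1_act_coset (PG1_act_coset L u) -GL_imageM.
by rewrite -PG1_act_coset; congr (val (PG1_act _ _)); rewrite morphM.
Qed.

Definition PGL2_action : {action PGL2 &-> PG1} := TotalAction PG1_act1 PG1_actM.

Lemma vline_PG1 (v : 'rV[F]_2) : v != 0%R -> \dim <[v]> == 1%N.
Proof. by move=> v0; rewrite dim_vline v0. Qed.

Lemma GL_image_line (v : 'rV[F]_2) (u : {'GL_2[F]}) :
  GL_image <[v]> u = <[(v *m GLval u)%R]>%VS.
Proof. by rewrite /GL_image limg_line lfunE. Qed.

Lemma PGL2_faithful : [faithful [set: PGL2], on [set: PG1] | PGL2_action].
Proof.
apply/subsetP=> x; rewrite inE => /andP[_ /astabP fixx].
have [u _ xu] := cosetP x; rewrite {}xu in fixx *.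
have fixv (v : 'rV[F]_2) : exists a, (v *m GLval u = a *: v)%R.
  have [->|v0] := eqVneq v 0%R; first by exists 0%R; rewrite mul0mx scaler0.
  pose L : PG1 := exist _ <[v]>%VS (vline_PG1 v0).
  have /(congr1 val) := fixx L (in_setT _).
  rewrite PG1_act_coset GL_image_line /= => fixL.
  by apply/vlineP; rewrite -fixL memv_line.
rewrite inE; apply/eqP/coset_id; rewrite inE; apply/is_scalar_mxP.
have [a ua] := fixv (delta_mx 0 0)%R.
have [b ub] := fixv (delta_mx 0 1)%R.
have [c uc] := fixv (delta_mx 0 0 + delta_mx 0 1)%R.
move: uc; rewrite mulmxDl ua ub => /rowP uc.
have ac : a = c by have := uc 0%R; rewrite !mxE /= !mulr0 !addr0 !mulr1.
have bc : b = c by have := uc 1%R; rewrite !mxE /= !mulr0 !add0r !mulr1.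
exists c; apply/row_matrixP=> i; rewrite !rowE mul_mx_scalar.
have [->|i0] := eqVneq i ord0; first by rewrite ua ac.
have -> : i = 1%R by apply: val_inj; case: i i0 => [[|[|]]] //.
by rewrite ub bc.
Qed.

Lemma PGL2_transitive :
  [transitive [set: PGL2], on [set: PG1] | PGL2_action].
Proof.
have e0 : (delta_mx 0%R 0%R : 'rV[F]_2) != 0%R.
  by apply/eqP=> /rowP/(_ 0%R)/eqP; rewrite !mxE oner_eq0.
apply/imsetP; exists (exist _ <[_]>%VS (vline_PG1 e0)); rewrite ?inE //.
apply/esym/setP=> L; rewrite !inE; apply/imsetP.
have [v v0 Lv] : exists2 v, v != 0%R & val L = <[v]>%VS.
  exists (vpick (val L)); first by rewrite vpick0 -dimv_eq0 (eqP (valP L)).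
  apply/esym/eqP; rewrite eqEdim -memvE memv_pick dim_vline (eqP (valP L)).
  by rewrite vpick0 -dimv_eq0 (eqP (valP L)).
pose u : {'GL_2[F]} :=
  FinRing.unit _ (row_ebase_unit v : row_ebase v \is a GRing.unit).
exists (coset _ u); rewrite ?inE //; apply: val_inj.
rewrite PG1_act_coset GL_image_line Lv /=.
have rv : \rank v = 1%N by rewrite rank_rV v0.
have := mulmx_ebase v; rewrite rv.
have -> : pid_mx 1 = delta_mx 0%R 0%R :> 'rV[F]_2.
  by apply/rowP=> j; rewrite !mxE /= andbT eq_sym.
rewrite [col_ebase v]mx11_scalar mul_scalar_mx -scalemxAl.
move=> vE; apply/eqP; rewrite eqEdim -memvE !dim_vline v0 leq_b1 andbT.
by rewrite -{1}vE memvZ ?memv_line.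
Qed.

End ProjectiveLine.

(* Main.v *)
(* The derangements are closed under inversion and conjugation, so inversion
   x |-> x^-1 is an automorphism of the derangement graph.  It conjugates the
   left translation by g to the right translation by g^-1, which is a left
   translation only if g is central; but PGL_2(q) is not abelian, since the
   point stabilisers of an abelian transitive faithful group are trivial,
   whereas a transvection fixes a point. *)
Require Import Defs.
From mathcomp Require Import all_boot all_order all_algebra all_fingroup.

Set Implicit Arguments.
Unset Strict Implicit.
Unset Printing Implicit Defensive.

Import GroupScope GRing.Theory.

(** Adjacency of [x^-1] and [y^-1] concerns [y * x^-1], whose conjugate by [x] is [x^-1 * y], the
    inverse of [y^-1 * x]. *)
Lemma inversion_graph_aut (gT : finGroupType) (D : {set gT}) :
    (forall g, (g^-1 \in D) = (g \in D)) ->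
    (forall g h, (g ^ h \in D) = (g \in D)) ->
  perm (@invg_inj gT) \in graph_aut (cayley_graph D).
Proof.
move=> DV DJ; apply/graph_autP=> x y; rewrite !permE /cayley_graph /= invgK.
rewrite -(DJ _ x) -DV; congr (_ \in D).
by rewrite conjgE mulgKV invMg invgK.
Qed.

Lemma normal_cayley_abelian (gT : finGroupType) (D : {set gT}) :
    (forall g, (g^-1 \in D) = (g \in D)) ->
    (forall g h, (g ^ h \in D) = (g \in D)) ->
  normal_cayley (cayley_graph D) -> abelian [set: gT].
Proof.
move=> DV DJ /normal_norm/subsetP/(_ _ (inversion_graph_aut DV DJ)) Ninv.
apply/centsP=> g _ h _.
have: left_translation g ^ perm (@invg_inj gT) \in left_regular gT.
  by rewrite memJ_norm // imset_f.
case/imsetP=> c _ /permP gc.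
have {}gc x : x * g^-1 = c * x.
  rewrite -(left_translationE c) -gc -{2}[x]invgK.
  rewrite -[x^-1^-1](permE (@invg_inj gT)) permJ.
  by rewrite left_translationE permE invMg invgK.
(* Evaluating at [x = 1] identifies [c], so [gc] now says that [g^-1] is central. *)
have cE : c = g^-1 by rewrite -[c]mulg1 -gc mul1g.
rewrite -[g]invgK; apply: commute_sym; apply: commuteV.
by rewrite /commute gc cE.
Qed.

Lemma derangementsV (gT : finGroupType) (Omega : finType)
    (to : {action gT &-> Omega}) g :
  (g^-1 \in derangements to) = (g \in derangements to).
Proof.
rewrite !inE; apply: eq_forallb => w.
by rewrite -(inj_eq (act_inj to g)) actKV eq_sym.
Qed.

(** [h] carries the fixed points of [g] onto those of [g ^ h]. *)
Lemma derangementsJ (gT : finGroupType) (Omega : finType)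
    (to : {action gT &-> Omega}) g h :
  (g ^ h \in derangements to) = (g \in derangements to).
Proof.
rewrite !inE; apply/forallP/forallP=> der w.
  by have := der (to w h); rewrite -actCJ (inj_eq (act_inj to h)).
by have := der (to w h^-1); rewrite -(inj_eq (act_inj to h)) actCJ actKV.
Qed.

(** Any point is the image of [w] under some [y] in [G]; since [x] commutes with [y], it fixes that
    point too. *)
Lemma abelian_trans_stab1 (gT : finGroupType) (Omega : finType)
    (to : {action gT &-> Omega}) (G : {group gT}) w x :
    abelian G -> [transitive G, on [set: Omega] | to] ->
    [faithful G, on [set: Omega] | to] ->
  x \in G -> to w x = w -> x = 1.
Proof.
move=> /centsP cGG trG /faithfulP ffulG Gx fixw; apply: ffulG => // v _.
have [y Gy ->] := atransP2 trG (in_setT w) (in_setT v).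
by rewrite -actM (cGG y Gy x Gx) actM fixw.
Qed.

Lemma PGL2_nonabelian (F : finFieldType) : ~~ abelian [set: PGL2 F].
Proof.
apply/negP=> cGG.
(* A transvection: [delta_mx 1 0] squares to zero, which gives the inverse, and its row 0 vanishes,
   so [A] fixes the row vector [delta_mx 0 0]. *)
pose A : 'M[F]_2 := (1%:M + delta_mx 1 0)%R.
have AV : (A *m (1%:M - delta_mx 1 0) = 1%:M)%R.
  rewrite mulmxDl !mulmxBr !mulmx1 mul1mx mul_delta_mx_cond /=.
  by rewrite mulr0n subr0 subrK.
have Au : A \is a GRing.unit by have [] := mulmx1_unit AV.
pose u : {'GL_2[F]} := FinRing.unit _ Au.
have e0 : (delta_mx 0 0 : 'rV[F]_2)%R != 0%R.
  by apply/eqP=> /rowP/(_ 0%R)/eqP; rewrite !mxE oner_eq0.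
pose L : PG1 F := exist _ <[_]>%VS (vline_PG1 e0).
have fixL : PGL2_action F L (coset (scalar_GL F) u) = L.
  apply: val_inj; rewrite PG1_act_coset GL_image_line /=; congr <[_]>%VS.
  by rewrite mulmxDr mulmx1 mul_delta_mx_cond mulr0n addr0.
have /coset_idr := abelian_trans_stab1 cGG (PGL2_transitive F)
  (PGL2_faithful F) (in_setT _) fixL.
have Nu : u \in 'N(scalar_GL F).
  by rewrite (subsetP (normal_norm (scalar_GL_normal F))) ?inE.
(* The entry (1, 0) of [A] is 1, whereas a scalar matrix has 0 there. *)
move=> /(_ Nu); rewrite inE => /is_scalar_mxP[a /matrixP/(_ 1 0)%R/eqP].
by rewrite !mxE /= mulr0n add0r oner_eq0.
Qed.

Theorem proposition1p2 (p k : nat) (hp : prime p) (hk : (0 < k)%N)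
    (F : finFieldType) (hF : #|F| = (p ^ k)%N) :
  ~~ normal_cayley (derangement_graph (PGL2_action F)).
Proof.
apply: contra (PGL2_nonabelian F); apply: normal_cayley_abelian.
  exact: derangementsV.
exact: derangementsJ.
Qed.
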